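(* Fix an integer $d\geq 2$. Then $$\lim_{p\to\infty}\frac{k\!\left(H_1(d,p)\right)}{p^{d+1}}=\frac{2^{d-1}}{(d+1)!\,\zeta(d)}.$$
   Context: A point of $\mathbb{Z}^d$ is primitive if it is nonzero and the gcd of its coordinates is $1$. For a positive integer $p$, $H_1(d,p)$ is the zonotope $\sum_x[0,x]$, where $x$ ranges over all primitive points of $\mathbb{Z}^d$ with $\|x\|_1\leq p$ whose first nonzero coordinate is positive. For a $d$-dimensional lattice polytope $P$ (vertices in $\mathbb{Z}^d$), $k(P)$ is the smallest integer $k$ such that some translate of $P$ by a vector of $\mathbb{Z}^d$ is contained in $[0,k]^d$. $\zeta$ is the Riemann zeta function. *)

(* Defs.v *)
From HB Require Import structures.
From mathcomp Require Import all_boot all_order all_algebra.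
From mathcomp Require Import all_classical all_reals all_analysis.
Set Implicit Arguments.
Unset Strict Implicit.
Unset Printing Implicit Defensive.
Import Order.TTheory GRing.Theory Num.Theory.
Import numFieldNormedType.Exports.
Local Open Scope classical_set_scope.
Local Open Scope ring_scope.

Definition primitive (d : nat) (x : 'rV[int]_d) : Prop :=
  x <> 0 /\ \big[gcdn/0%N]_(i < d) absz (x 0 i) = 1%N.

Definition norm1 (d : nat) (x : 'rV[int]_d) : int := \sum_(i < d) `|x 0 i|.

Definition first_nonzero_pos (d : nat) (x : 'rV[int]_d) : Prop :=
  exists i : 'I_d, 0 < x 0 i /\ forall j : 'I_d, (j < i)%N -> x 0 j = 0.

Definition H1_generators (d p : nat) : set 'rV[int]_d :=
  [set x | [/\ primitive x, norm1 x <= p%:Z & first_nonzero_pos x]].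
Arguments H1_generators : clear implicits.

Definition embed (R : realType) (d : nat) (x : 'rV[int]_d) : 'rV[R]_d :=
  map_mx intr x.

Definition segment (R : realType) (d : nat) (a b : 'rV[R]_d) : set 'rV[R]_d :=
  [set (1 - t) *: a + t *: b | t in `[0, 1]].

(* Intended for a finite index set A: \sum_(i \in A) is 0 by convention when
   the support of the summand is infinite. *)
Definition minkowski_sum (R : realType) (d : nat) (I : choiceType)
    (A : set I) (F : I -> set 'rV[R]_d) : set 'rV[R]_d :=
  [set v | exists y : I -> 'rV[R]_d,
     (forall i, A i -> F i (y i)) /\ v = \sum_(i \in A) y i].

Definition H1 (R : realType) (d p : nat) : set 'rV[R]_d :=
  minkowski_sum (H1_generators d p) (fun x => segment 0 (embed R x)).
Arguments H1 : clear implicits.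

Definition cube (R : realType) (d : nat) (k : int) : set 'rV[R]_d :=
  [set v | forall i, 0 <= v 0 i <= k%:~R].

Definition fits_in_cube (R : realType) (d : nat) (P : set 'rV[R]_d) (k : int) :
    Prop :=
  exists z : 'rV[int]_d, [set v + embed R z | v in P] `<=` cube k.

Definition is_least_cube (R : realType) (d : nat) (P : set 'rV[R]_d) (k : int) :
    Prop :=
  fits_in_cube P k /\ forall m : int, fits_in_cube P m -> k <= m.

(* k(P); the default 0 is used only when there is no least k, which does not
   happen for nonempty bounded P and d > 0 (see cube_sizeP). *)
Definition cube_size (R : realType) (d : nat) (P : set 'rV[R]_d) : int :=
  xget 0 [set k | is_least_cube P k].

(* zeta(s) for real s > 1, by its Dirichlet series:
   riemannR s n = 1 / (n + 1) `^ s. *)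
Definition zeta (R : realType) (s : R) : R := limn (series (riemannR s)).

Lemma finite_H1_generators (d p : nat) : finite_set (H1_generators d p).
Proof.
pose f (g : {ffun 'I_d -> 'I_(p + p).+1}) : 'rV[int]_d :=
  \row_i ((g i : nat)%:Z - p%:Z).
apply: (@sub_finite_set _ _ (f @` setT)); last first.
  by apply: finite_image; exact: finite_finset.
move=> x [_ xp _].
have xi i : `|x 0 i| <= p%:Z.
  apply: le_trans xp; rewrite /norm1 (bigD1 i) //= lerDl.
  by apply: sumr_ge0.
exists [ffun i => inord (absz (x 0 i + p%:Z))] => //.
apply/rowP => i; rewrite mxE ffunE.
have /andP[h1 h2] : - p%:Z <= x 0 i <= p%:Z by rewrite -ler_norml.
have h0 : 0 <= x 0 i + p%:Z by rewrite -lerBlDr sub0r.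
rewrite inordK ?gez0_abs ?addrK//.
by rewrite ltnS -lez_nat gez0_abs// PoszD lerD2r.
Qed.

Lemma cube_sizeP (R : realType) (d : nat) (P : set 'rV[R]_d) :
  (0 < d)%N -> P !=set0 ->
  (exists M : R, forall v, P v -> forall i, `|v 0 i| <= M) ->
  is_least_cube P (cube_size P).
Proof.
move=> d0 [v0 Pv0] [M PM].
have fit0 (k : int) : fits_in_cube P k -> 0 <= k.
  case=> z /(_ (v0 + embed R z)) h.
  have /andP[] := h (ex_intro2 _ _ v0 Pv0 erefl) (Ordinal d0).
  by move=> a b; rewrite -(ler0z R) (le_trans a b).
have [n Mn] : exists n : nat, M <= n%:R.
  exists (Num.truncn `|M|).+1.
  by rewrite (le_trans (ler_norm _))// ltW// truncnS_gt.
have exk : exists k : nat, `[< fits_in_cube P k%:Z >].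
  exists (n + n)%N; apply/asboolP; exists (const_mx n%:Z) => _ [v Pv <-] i.
  rewrite !mxE.
  have := le_trans (PM v Pv i) Mn; rewrite ler_norml => /andP[a b].
  by rewrite -lerBlDr sub0r a/= PoszD intrD lerD2r.
have [k /asboolP fk kmin] := ex_minnP exk.
rewrite /cube_size; case: xgetP => [m -> //|/(_ k%:Z)[]].
split=> // m fm; have := fit0 m fm; case: m fm => // m fm _.
by rewrite lez_nat; apply: kmin; exact/asboolP.
Qed.

Lemma H1_cube_sizeP (R : realType) (d p : nat) : (0 < d)%N ->
  is_least_cube (H1 R d p) (cube_size (H1 R d p)).
Proof.
move=> d0; apply: cube_sizeP => //.
  exists (\sum_(x \in H1_generators d p) (0 : 'rV[R]_d)); exists (fun=> 0).
  split=> // x _; exists 0; first by rewrite /= in_itv/= lexx ler01.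
  by rewrite scale0r scaler0 addr0.
exists (\sum_(x \in H1_generators d p) \sum_i `|embed R x 0 i|).
move=> v [y [yP ->]] i.
rewrite !fsbig_finite ?summxE; do ?exact: finite_H1_generators.
rewrite (le_trans (ler_norm_sum _ _ _))//= big_seq [leRHS]big_seq.
apply: ler_sum => x; rewrite in_fset_set; last exact: finite_H1_generators.
rewrite inE => Ax; have [t /=] := yP _ Ax.
rewrite in_itv/= => /andP[t0 t1] <-.
rewrite scaler0 add0r mxE normrM (ger0_norm t0) (bigD1 i)//=.
apply: (@le_trans _ _ `|embed R x 0 i|); first exact: ler_piMl.
by rewrite lerDl sumr_ge0.
Qed.

(* Main.v *)
Require Import Defs.
From HB Require Import structures.
From mathcomp Require Import all_boot all_order all_algebra.
From mathcomp Require Import all_classical all_reals all_analysis.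
From mathcomp Require Import perm zify ring lra.
Set Implicit Arguments.
Unset Strict Implicit.
Unset Printing Implicit Defensive.
Import Order.TTheory GRing.Theory Num.Theory.
Import numFieldNormedType.Exports.
Local Open Scope classical_set_scope.
Local Open Scope ring_scope.

(* Every generator contributes |x_i| to the width of the zonotope in direction i
   and the widths agree by symmetry, so k(H_1(d,p)) is half of
   a(p) := \sum |x_i| over the primitive points of the l1-ball of radius p.
   Sorting all points of the ball by the gcd of their coordinates gives
   A(n) := \sum_(|x|_1 <= n) |x_i| = \sum_(1 <= g <= n) g a(floor (n / g)),
   and A(n) ~ 2^d n^(d+1) / (d+1)! by counting lattice points.  This relation is
   inverted without the Moebius function: with K = 2^d / ((d+1)! zeta(d)) the
   error D(n) = a(n) - K n^(d+1) satisfies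
   \sum_(1 <= g <= n) g D(floor (n / g)) = o(n^(d+1)), and since
   \sum_(g >= 2) g^-d <= 3/4 < 1 any bound |D(n)| <= M n^(d+1) + O(1)
   improves to one with 7/8 M in place of M; hence D(n) = o(n^(d+1)). *)

(** * Lattice points of the l1-ball *)

Definition ball1 (d n : nat) : set 'rV[int]_d := [set x | norm1 x <= n%:Z].
Arguments ball1 : clear implicits.

Lemma norm_coord_le (d : nat) (x : 'rV[int]_d) i : `|x 0 i| <= norm1 x.
Proof. by rewrite /norm1 (bigD1 i) //= lerDl sumr_ge0. Qed.

Lemma finite_ball1 (d n : nat) : finite_set (ball1 d n).
Proof.
pose f (g : {ffun 'I_d -> 'I_(n + n).+1}) : 'rV[int]_d :=
  \row_i ((g i : nat)%:Z - n%:Z).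
apply: (@sub_finite_set _ _ (f @` setT)); last first.
  by apply: finite_image; exact: finite_finset.
move=> x xn; have xi i := le_trans (norm_coord_le x i) xn.
exists [ffun i => inord (absz (x 0 i + n%:Z))] => //.
by apply/rowP => i; rewrite mxE ffunE inordK; have := xi i; lia.
Qed.

Lemma fsum_fibres (V : zmodType) (T : choiceType) (A : set T) (f : T -> nat)
    (N : nat) (F : T -> V) :
  finite_set A -> (forall x, A x -> (f x < N)%N) ->
  \sum_(x \in A) F x =
  \sum_(g < N) \sum_(x \in A `&` [set x | f x = g]) F x.
Proof.
move=> finA fN.
under [RHS]eq_bigr do rewrite fsbig_mkcondr fsbig_finite//.
rewrite exchange_big/= fsbig_finite//; apply: eq_big_seq => x.
rewrite in_fset_set// inE => /fN fx.
rewrite (bigD1 (Ordinal fx))//= mem_set//= big1 ?addr0// => g gx.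
by rewrite memNset//= => /esym gE; move/eqP: gx; apply; exact/val_inj.
Qed.

Definition cons_row (d : nat) (t : int) (y : 'rV[int]_d) : 'rV[int]_d.+1 :=
  \row_j oapp (y 0) t (unlift ord0 j).

Lemma cons_row0 d t (y : 'rV[int]_d) : cons_row t y 0 ord0 = t.
Proof. by rewrite mxE unlift_none. Qed.

Lemma cons_rowS d t (y : 'rV[int]_d) j : cons_row t y 0 (lift ord0 j) = y 0 j.
Proof. by rewrite mxE liftK. Qed.

Lemma norm1_cons_row d t (y : 'rV[int]_d) :
  norm1 (cons_row t y) = `|t| + norm1 y.
Proof.
by rewrite /norm1 big_ord_recl cons_row0; under eq_bigr do rewrite cons_rowS.
Qed.

Lemma cons_row_bij d n (t : int) : (absz t <= n)%N ->
  set_bij (ball1 d (n - absz t)) (ball1 d.+1 n `&` [set x | x 0 ord0 = t])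
    (cons_row t).
Proof.
move=> tn; split.
- move=> y /=; rewrite /ball1 /= => yn; split; last exact: cons_row0.
  by rewrite /= norm1_cons_row; lia.
- move=> y z _ _ yz; apply/rowP => j.
  by rewrite -(cons_rowS t y) yz cons_rowS.
- move=> x [xn xt]; have xE : cons_row t (\row_j x 0 (lift ord0 j)) = x.
    apply/rowP => j; case: (unliftP ord0 j) => [k|] ->.
      by rewrite cons_rowS mxE.
    by rewrite cons_row0 -xt.
  exists (\row_j x 0 (lift ord0 j)) => //.
  move: xn; rewrite /ball1 /= -{1}xE norm1_cons_row.
  by move: (norm1 _) => w; lia.
Qed.

Definition ball1_card (d n : nat) : int := \sum_(x \in ball1 d n) (1 : int).

(** The slice with first coordinate t is a copy of the ball of radius n - |t| one dimension lower.
    The slices at m and -m coincide only for m = 0, hence the weight 1 or 2. *)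
Lemma sum_ball1_head (d n : nat) (G : nat -> int) :
  \sum_(x \in ball1 d.+1 n) G (absz (x 0 ord0)) =
  \sum_(m < n.+1) G m * (m != 0%N :> nat).+1%:Z * ball1_card d (n - m).
Proof.
rewrite (fsum_fibres (f := fun x : 'rV_d.+1 => absz (x 0 ord0)) (N := n.+1)).
- apply: eq_bigr => -[m mn] _ /=.
  have slice (t : int) : absz t = m ->
      \sum_(x \in ball1 d.+1 n `&` [set x | x 0 ord0 = t]) G (absz (x 0 ord0))
      = G m * ball1_card d (n - m).
    move=> tm; have tn : (absz t <= n)%N by lia.
    rewrite (reindex_fsbig _ _ _ _ (cons_row_bij d tn)).
    rewrite tm /ball1_card mulr_fsumr.
    by apply: eq_fsbigr => y _; rewrite cons_row0 tm mulr1.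
  case: m => [|m] in mn slice *.
    rewrite mulr1 -(slice 0)//; apply: eq_fsbigl; congr (_ `&` _).
    by apply/seteqP; split=> x /=; lia.
  rewrite mulrAC [_%:Z](_ : _ = 1 + 1)// mulrDr mulr1.
  rewrite -{1}(slice m.+1%:Z)// -(slice (- m.+1%:Z)) ?abszN//.
  rewrite -fsbigU0.
  - apply: eq_fsbigl; rewrite -setIUr; congr (_ `&` _).
    by apply/seteqP; split=> x /=; lia.
  - exact/finite_setIl/finite_ball1.
  - exact/finite_setIl/finite_ball1.
  - by move=> x [[_ /= ->] [_ /=]]; lia.
- exact: finite_ball1.
- move=> x; have := norm_coord_le x ord0; rewrite /ball1/=; lia.
Qed.

Lemma ball1_card0 n : ball1_card 0 n = 1.
Proof.
rewrite /ball1_card (_ : ball1 0 n = [set 0]) ?fsbig_set1//.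
apply/seteqP; split=> x; rewrite /ball1 /norm1 /= big_ord0; last by lia.
by move=> _; apply/rowP => -[].
Qed.

Lemma ball1_cardS d n :
  ball1_card d.+1 n =
  \sum_(m < n.+1) (m != 0%N :> nat).+1%:Z * ball1_card d (n - m).
Proof.
rewrite {1}/ball1_card (sum_ball1_head d n (fun=> 1)).
by under eq_bigr do rewrite mul1r.
Qed.

Lemma hockey_stick (d n : nat) : (\sum_(k < n) 'C(k, d) = 'C(n, d.+1))%N.
Proof.
elim: n => [|n IH]; first by rewrite big_ord0.
by rewrite big_ord_recr/= IH binS.
Qed.

Lemma hockey_stick_shift (d n : nat) :
  (\sum_(k < n) 'C(k + d, d) = 'C(n + d, d.+1))%N.
Proof.
elim: n => [|n IH]; first by rewrite big_ord0 add0n bin_small.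
by rewrite big_ord_recr/= IH addSn binS.
Qed.

(** Induction on d by slicing: dropping the slice m = 0 gives the lower bound, counting it twice the
    upper one. Both bounds are 2^d n^d / d! to leading order. *)
Lemma ball1_card_bounds d n :
  (2 ^ d * 'C(n, d))%N%:Z <= ball1_card d n <= (2 ^ d * 'C(n + d, d))%N%:Z.
Proof.
elim: d n => [|d IH] n; first by rewrite ball1_card0 !bin0.
rewrite ball1_cardS; apply/andP; split.
- rewrite big_ord_recl/= -hockey_stick expnS -mulnA big_distrr/=.
  rewrite ler_wpDl//.
    by rewrite mulr_ge0//; have /andP[+ _] := IH (n - 0)%N; apply: le_trans.
  rewrite PoszM -natz -[X in _ * X]natz natr_sum mulr_sumr.
  rewrite (reindex_inj rev_ord_inj)/=; apply: ler_sum => -[k kn] _ /=.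
  rewrite ler_pM2l// natz; have /andP[+ _] := IH (n - bump 0 k)%N.
  by rewrite /bump add1n.
- have -> : (n + d.+1 = n.+1 + d)%N by lia.
  rewrite -hockey_stick_shift expnS -mulnA big_distrr/=.
  rewrite PoszM -natz -[X in _ * X]natz natr_sum mulr_sumr.
  rewrite (reindex_inj rev_ord_inj)/=; apply: ler_sum => -[k kn] _ /=.
  have /andP[l u] := IH (n - (n.+1 - k.+1))%N.
  apply: ler_pM => //; first by apply: le_trans l.
    by case: (_ == _).
  by rewrite natz (le_trans u)// lez_nat leq_mul2l leq_bin2l ?orbT//; lia.
Qed.

Definition coord_mass (d : nat) (A : set 'rV[int]_d) (i : 'I_d) : int :=
  \sum_(x \in A) `|x 0 i|.

(** From n to n + 1 every weight m grows by one, which adds the sum of [ball1_card d k] over k <= n.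
    The double sum is made for two uses of the hockey-stick identity. *)
Lemma coord_mass_ball1E d n :
  coord_mass (ball1 d.+1 n) ord0 =
  2 * \sum_(j < n.+1) \sum_(k < j) ball1_card d k.
Proof.
rewrite /coord_mass.
under eq_fsbigr do rewrite -abszE.
rewrite (sum_ball1_head d n Posz).
transitivity (2 * \sum_(m < n.+1) m%:Z * ball1_card d (n - m)).
  by rewrite mulr_sumr; apply: eq_bigr => -[[|m] mn] _ //=; lia.
congr (_ * _); elim: n => [|n IH].
  by rewrite !big_ord1 mul0r big_ord0.
rewrite [RHS]big_ord_recr/= -IH big_ord_recl mul0r add0r.
rewrite [X in _ = _ + X](reindex_inj rev_ord_inj)/= -big_split/=.
apply: eq_bigr => -[m mn] _ /=.
by rewrite /bump /= !add1n subSS; lia.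
Qed.

Lemma coord_mass_ball1_bounds d n :
  (2 ^ d.+1 * 'C(n.+1, d.+2))%N%:Z <= coord_mass (ball1 d.+1 n) ord0
    <= (2 ^ d.+1 * 'C(n + d.+1, d.+2))%N%:Z.
Proof.
rewrite coord_mass_ball1E; apply/andP; split.
- rewrite expnS -mulnA PoszM ler_pM2l// -hockey_stick big_distrr/=.
  rewrite -natz natr_sum; apply: ler_sum => j _.
  rewrite -hockey_stick big_distrr/= natr_sum; apply: ler_sum => k _.
  by rewrite natz; case/andP: (ball1_card_bounds d k).
- rewrite expnS -mulnA PoszM ler_pM2l//.
  (* The term j = 0 vanishes; the others form a shifted hockey stick. *)
  have -> : 'C(n + d.+1, d.+2) = (\sum_(j < n.+1) 'C(j + d, d.+1))%N.
    rewrite big_ord_recl (bin_small (ltnSn _)) add0n -hockey_stick_shift.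
    by apply: eq_bigr => j _; rewrite /= /bump add1n addSnnS.
  rewrite big_distrr/= -natz natr_sum; apply: ler_sum => j _.
  rewrite -hockey_stick_shift big_distrr/= natr_sum; apply: ler_sum => k _.
  by rewrite natz; case/andP: (ball1_card_bounds d k).
Qed.

(** * Primitive points and sorting by gcd *)

Definition prim_ball (d n : nat) : set 'rV[int]_d :=
  [set x | primitive x /\ norm1 x <= n%:Z].
Arguments prim_ball : clear implicits.

Lemma finite_prim_ball d n : finite_set (prim_ball d n).
Proof. by apply: sub_finite_set (@finite_ball1 d n) => x []. Qed.

Definition row_gcd (d : nat) (x : 'rV[int]_d) : nat :=
  \big[gcdn/0%N]_(i < d) absz (x 0 i).

Lemma primitiveP d (x : 'rV[int]_d) : primitive x <-> row_gcd x = 1%N.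
Proof.
split=> [[]//|x1]; split=> // x0; move: x1.
by rewrite x0 /row_gcd big1// => i _; rewrite mxE.
Qed.

Lemma row_gcdZ d (g : nat) (x : 'rV[int]_d) :
  row_gcd (g%:Z *: x) = (g * row_gcd x)%N.
Proof.
rewrite /row_gcd; elim/big_ind2: _ => [|a a' b b' -> ->|i _].
- by rewrite muln0.
- by rewrite muln_gcdr.
- by rewrite mxE abszM.
Qed.

Lemma norm1Z d (g : nat) (x : 'rV[int]_d) :
  norm1 (g%:Z *: x) = g%:Z * norm1 x.
Proof.
by rewrite /norm1 mulr_sumr; apply: eq_bigr => i _; rewrite mxE normrM.
Qed.

Lemma row_gcd_dvd d (x : 'rV[int]_d) i : (row_gcd x %| absz (x 0%R i))%N.
Proof. by rewrite /row_gcd (bigD1 i)//= dvdn_gcdl. Qed.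

(** A point of gcd g > 0 is g times a unique primitive point y, and g |y| <= n means |y| <= floor (n
    / g). *)
Lemma prim_ball_scale_bij d n g : (0 < g)%N ->
  set_bij (prim_ball d (n %/ g))
    (ball1 d n `&` [set x | row_gcd x = g]) (fun y => g%:Z *: y).
Proof.
move=> g0; split.
- move=> y [[_ y1] yn]; split.
    rewrite /ball1/= norm1Z; have := leq_trunc_div n g; nia.
  by rewrite /= row_gcdZ [row_gcd y]y1 muln1.
- move=> y z _ _ /rowP yz; apply/rowP => i; have := yz i; rewrite !mxE.
  by apply: mulfI; rewrite -lt0n.
- move=> x [xn xg]; pose y : 'rV[int]_d := \row_i (x 0%R i %/ g%:Z)%Z.
  have yE : g%:Z *: y = x.
    apply/rowP => i; rewrite !mxE mulrC divzK//.
    by have := row_gcd_dvd x i; rewrite xg.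
  have y1 : row_gcd y = 1%N.
    apply/eqP; rewrite -(eqn_pmul2l g0) muln1 -row_gcdZ yE; exact/eqP.
  exists y => //; split; first exact/primitiveP.
  move: xn; rewrite /ball1 /= -yE norm1Z.
  have : 0 <= norm1 y by apply: sumr_ge0.
  case: (norm1 y) => // m _; rewrite -PoszM !lez_nat leq_divRL//; lia.
Qed.

Lemma coord_mass_gcd d n i :
  coord_mass (ball1 d n) i =
  \sum_(g < n.+1) g%:Z * coord_mass (prim_ball d (n %/ g)) i.
Proof.
have gcd0 (x : 'rV[int]_d) : row_gcd x = 0%N -> x = 0.
  move=> x0; apply/rowP => j; rewrite mxE.
  by have := row_gcd_dvd x j; rewrite x0 dvd0n absz_eq0 => /eqP.
rewrite /coord_mass (fsum_fibres (f := @row_gcd d) (N := n.+1)).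
- apply: eq_bigr => -[[|g] gn] _ /=.
    (* Only the origin has gcd 0, and it has no mass. *)
    by rewrite mul0r fsbig1// => x [_ /gcd0 ->]; rewrite mxE.
  rewrite (reindex_fsbig _ _ _ _ (prim_ball_scale_bij d n (ltn0Sn g))).
  by rewrite mulr_fsumr; apply: eq_fsbigr => x _; rewrite mxE normrM.
- exact: finite_ball1.
(* A nonzero gcd divides some nonzero coordinate, so it is at most n. *)
- move=> x xn; have [//|x0] := posnP (row_gcd x); first by move=> ->.
  have [j xj] : exists j, x 0 j != 0.
    apply/existsP; apply: contraTT x0 => /existsPn x0.
    rewrite -eqn0Ngt /row_gcd big1// => j _.
    by move/negPn/eqP: (x0 j) => ->.
  have /dvdn_leq := row_gcd_dvd x j; rewrite absz_gt0 => /(_ xj).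
  have := norm_coord_le x j; move: xn; rewrite /ball1/=; lia.
Qed.

(** * The width of the zonotope *)

Lemma row_gcd_col_perm d (s : 'S_d) (x : 'rV[int]_d) :
  row_gcd (col_perm s x) = row_gcd x.
Proof.
rewrite /row_gcd [RHS](reindex_inj (@perm_inj _ s))/=.
by apply: eq_bigr => i _; rewrite mxE.
Qed.

Lemma norm1_col_perm d (s : 'S_d) (x : 'rV[int]_d) :
  norm1 (col_perm s x) = norm1 x.
Proof.
rewrite /norm1 [RHS](reindex_inj (@perm_inj _ s))/=.
by apply: eq_bigr => i _; rewrite mxE.
Qed.

(** Swapping two coordinates preserves gcd and norm. The sign condition in [H1_generators] is not
    invariant under such swaps, so the symmetry is proved on the whole ball. *)
Lemma coord_mass_prim_ball_sym d n (i j : 'I_d) :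
  coord_mass (prim_ball d n) i = coord_mass (prim_ball d n) j.
Proof.
pose s := tperm i j.
have sK : involutive (col_perm s : 'rV[int]_d -> 'rV[int]_d).
  by move=> x; apply/rowP => k; rewrite !mxE tpermK.
rewrite /coord_mass (reindex_fsbig (col_perm s) (prim_ball d n) (prim_ball d n)).
  by apply: eq_fsbigr => x _; rewrite mxE tpermL.
have stable x : prim_ball d n x -> prim_ball d n (col_perm s x).
  move=> [/primitiveP x1 xn]; split; last by rewrite norm1_col_perm.
  by apply/primitiveP; rewrite row_gcd_col_perm.
split=> //.
- by move=> x y _ _ /(congr1 (col_perm s)); rewrite !sK.
- by move=> x xn; exists (col_perm s x); [exact: stable | exact: sK].
Qed.

(** The sign condition selects exactly one of x and -x, so the primitive points split into the
    generators and their negatives. *)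
Lemma first_nonzero_posN d (x : 'rV[int]_d) :
  x <> 0 -> first_nonzero_pos (- x) <-> ~ first_nonzero_pos x.
Proof.
move=> x0; split.
  move=> [i [xi0 xi]] [j [xj0 xj]].
  have [ij|ji|/val_inj ij] := ltngtP i j.
  - by move: xi0; rewrite mxE (xj _ ij).
  - move: (xi _ ji); rewrite mxE => /eqP; rewrite oppr_eq0 => /eqP xj_eq0.
    by move: xj0; rewrite xj_eq0.
  - by move: xi0; rewrite mxE oppr_gt0 ij ltNge ltW.
have [i0 xi0] : exists i, x 0 i != 0.
  apply: contra_notP x0 => /forallNP x0; apply/rowP => i; rewrite mxE.
  by apply/eqP/negPn/negP/x0.
have [i xi imin] := @arg_minnP _ i0 (fun i => x 0 i != 0) (fun i : 'I_d => i : nat) xi0.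
have zero (j : 'I_d) : (j < i)%N -> x 0 j = 0.
  move=> ji; apply: contraTeq ji => xj; rewrite -leqNgt; exact: imin.
move=> xN; exists i; split=> [|j ji]; last by rewrite mxE zero ?oppr0.
rewrite mxE oppr_gt0 lt_neqAle xi/= leNgt; apply/negP => xi_gt0.
by apply: xN; exists i.
Qed.

Lemma coord_mass_prim_ballE d n (i : 'I_d) :
  coord_mass (prim_ball d n) i = 2 * coord_mass (H1_generators d n) i.
Proof.
rewrite /coord_mass (fsbigID [set x | first_nonzero_pos x]) /=; last first.
  exact: finite_prim_ball.
rewrite (mulrDl 1 1) mul1r; congr (_ + _).
  by apply: eq_fsbigl; apply/seteqP; split=> x /=; [case=> -[]|case].
have bijN : set_bij (H1_generators d n)
    (prim_ball d n `&` ~` [set x | first_nonzero_pos x]) -%R.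
  have normN (x : 'rV[int]_d) : norm1 (- x) = norm1 x.
    by apply: eq_bigr => k _; rewrite mxE normrN.
  have primN (x : 'rV[int]_d) : primitive x -> primitive (- x).
    move=> /primitiveP x1; apply/primitiveP; rewrite -[RHS]x1.
    by apply: eq_bigr => k _; rewrite mxE abszN.
  split.
  - move=> x [xp xn xf]; split; first by split; [exact: primN|rewrite normN].
    move=> xfN; have [x0 _] := xp.
    by move/(first_nonzero_posN x0): xfN; apply.
  - by move=> x y _ _ /oppr_inj.
  - move=> x [[xp xn] /= xf]; exists (- x); last exact: opprK.
    split; [exact: primN | by rewrite normN |].
    by have [x0 _] := xp; exact/first_nonzero_posN.
rewrite (reindex_fsbig _ _ _ _ bijN).
by apply: eq_fsbigr => x _; rewrite mxE normrN.
Qed.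

(** Upper bound: a translation brings the minimum of every coordinate to 0, and all widths agree.
    Lower bound: two points of the zonotope realise the width in direction 0. *)
Lemma cube_size_H1 (R : realType) d p :
  cube_size (H1 R d.+1 p) = coord_mass (H1_generators d.+1 p) ord0.
Proof.
have [fit least] := @H1_cube_sizeP R d.+1 p isT.
pose G := H1_generators d.+1 p.
have finG : finite_set G by exact: finite_H1_generators.
(* Symmetry of the full ball, halved. *)
have mass_sym i : coord_mass G i = coord_mass G ord0.
  apply: (@mulfI _ (2 : int)) => //.
  by rewrite -!coord_mass_prim_ballE; exact: coord_mass_prim_ball_sym.
apply/eqP; rewrite eq_le; apply/andP; split.
- apply: least.
  (* The minimum of coordinate i on the zonotope is the sum of the negative [x 0 i]; the translation
     cancels it. *)
  exists (\row_i \sum_(x \in G) Num.max (- x 0 i) 0) => _ [v [y [yG ->]] <-] i.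
  rewrite -(mass_sym i) /coord_mass !fsbig_finite//.
  rewrite !mxE summxE fsbig_finite// !rmorph_sum/= -big_split/=.
  have term (x : 'rV[int]_d.+1) : G x ->
      0 <= y x 0 i + (Num.max (- x 0 i) 0)%:~R <= `|x 0 i|%:~R.
    move=> /yG[t]; rewrite /= in_itv/= => /andP[t0 t1] <-.
    rewrite scaler0 add0r !mxE.
    have [x0|x0] := leP 0 (x 0 i).
      rewrite max_r ?oppr_le0// ger0_norm// addr0.
      by rewrite mulr_ge0 ?ler0z//= ler_piMl ?ler0z.
    rewrite max_l; last by rewrite oppr_ge0 ltW.
    rewrite ltr0_norm // mulrNz.
    have : (x 0 i)%:~R <= 0 :> R by rewrite lerz0 ltW.
    by nra.
  apply/andP; split; rewrite big_seq.
    by apply: sumr_ge0 => x; rewrite in_fset_set// inE => /term/andP[].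
  by rewrite [leRHS]big_seq; apply: ler_sum => x; rewrite in_fset_set// inE => /term/andP[].
- have [z zP] := fit.
  (* [V (> 0)] and [V (< 0)] maximise and minimise coordinate 0; they differ there by the sum of all
     |x_0|. *)
  pose V (P : pred int) : 'rV[R]_d.+1 :=
    \sum_(x \in G) (if P (x 0 ord0) then embed R x else 0).
  have VH (P : pred int) : H1 R d.+1 p (V P).
    exists (fun x : 'rV[int]_d.+1 => if P (x 0 ord0) then embed R x else 0).
    split=> // x _; case: ifP => _.
      by exists 1; rewrite ?subrr ?scale0r ?add0r ?scale1r//= in_itv/= ler01 lexx.
    by exists 0; rewrite ?scaler0 ?add0r ?scale0r//= in_itv/= ler01 lexx.
  have /(_ (V (> 0) + embed R z)) := zP; move/(_ (ex_intro2 _ _ _ (VH _) erefl) ord0).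
  have /(_ (V (< 0) + embed R z)) := zP; move/(_ (ex_intro2 _ _ _ (VH _) erefl) ord0).
  rewrite !mxE => /andP[lo _] /andP[_ hi].
  rewrite -(ler_int R); apply: le_trans (_ : V (> 0) 0 ord0 - V (< 0) 0 ord0 <= _).
    rewrite /V /coord_mass !fsbig_finite// !summxE rmorph_sum/= -sumrB.
    apply: ler_sum => x _; have [x0|x0|x0] := ltrgt0P (x 0 ord0).
    - by rewrite !mxE subr0.
    - by rewrite !mxE sub0r mulrNz.
    - by rewrite !mxE subr0.
  by lra.
Qed.

(** * The zeta series *)

(** Reduce to exponent 2 and telescope 1/(x+1)^2 <= 1/x - 1/(x+1) after the first term 1/4, which
    leaves 1/4 + 1/2. *)
Lemma sum_inv_exp_le (R : realType) d n : (2 <= d)%N ->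
  \sum_(g < n) (g.+2%:R ^+ d)^-1 <= 3 / 4 :> R.
Proof.
move=> d2.
have sq m : \sum_(g < m.+1) (g.+2%:R ^+ 2)^-1 <= 3 / 4 - m.+2%:R^-1 :> R.
  elim: m => [|m IH]; first by rewrite big_ord1/= expr2; lra.
  rewrite big_ord_recr/=; apply: le_trans (lerD IH (lexx _)) _.
  have x0 : 0 < m.+2%:R :> R by [].
  have -> : m.+3%:R = m.+2%:R + 1 :> R by rewrite -[m.+3]addn1 natrD.
  move: (m.+2%:R : R) x0 => x x0.
  rewrite -subr_ge0.
  have -> : 3 / 4 - (x + 1)^-1 - (3 / 4 - x^-1 + ((x + 1) ^+ 2)^-1) =
     (x * (x + 1) ^+ 2)^-1.
    by field; rewrite ?gt_eqF//; lra.
  by rewrite invr_ge0 mulr_ge0 ?sqr_ge0 ?ltW.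
case: n => [|n]; first by rewrite big_ord0; lra.
apply: le_trans (_ : 3 / 4 - n.+2%:R^-1 <= _); last by rewrite lerBlDr lerDl.
apply: le_trans (sq n); apply: ler_sum => g _.
by rewrite lef_pV2 ?posrE ?exprn_gt0// ler_weXn2l// ler1n.
Qed.

Lemma series_riemannRE (R : realType) d n :
  series (riemannR (d%:R : R)) n = \sum_(g < n) (g.+1%:R ^+ d)^-1.
Proof.
by rewrite /series /= big_mkord; apply: eq_bigr => g _; rewrite /riemannR powR_mulrn.
Qed.

Lemma series_riemannR_cvg (R : realType) d : (2 <= d)%N ->
  series (riemannR (d%:R : R)) n @[n --> \oo] --> zeta (d%:R : R).
Proof.
move=> d2; apply: nondecreasing_is_cvgn.
  by apply: nondecreasing_series => n _ _; rewrite ltW// riemannR_gt0.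
exists (1 + 3 / 4) => _ [n _ <-]; rewrite series_riemannRE.
case: n => [|n]; first by rewrite big_ord0; lra.
by rewrite big_ord_recl expr1n invr1 lerD2l sum_inv_exp_le.
Qed.

Lemma zeta_gt0 (R : realType) d : (2 <= d)%N -> 0 < zeta (d%:R : R).
Proof.
move=> d2; apply: lt_le_trans ltr01 _.
have cv := @series_riemannR_cvg R d d2.
rewrite -(cvg_lim (@Rhausdorff R) cv); apply: limr_ge; first exact/cvgP/cv.
near=> n; have n0 : (0 < n)%N by near: n; exists 1%N.
rewrite -(prednK n0) series_riemannRE big_ord_recl expr1n invr1 lerDl.
by apply: sumr_ge0 => g _; rewrite invr_ge0 exprn_ge0.
Unshelve. all: by end_near. Qed.

(** The quotient of the difference by x - y is a sum of q + 1 monomials, each at most x^q. It will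
    measure the loss in replacing n / g by its floor. *)
Lemma subrXX_le (R : realDomainType) (x y : R) q : 0 <= y <= x -> x - y <= 1 ->
  x ^+ q.+1 - y ^+ q.+1 <= q.+1%:R * x ^+ q.
Proof.
move=> /andP[y0 yx] xy1; have x0 := le_trans y0 yx.
rewrite subrXX -[leRHS]mul1r; apply: ler_pM => //.
- by rewrite subr_ge0.
- by apply: sumr_ge0 => i _; rewrite mulr_ge0// exprn_ge0.
rewrite mulr_natl -[X in _ *+ X]card_ord -sumr_const; apply: ler_sum => -[i iq] _ /=.
rewrite -[in leRHS](@subnK i q)// exprD.
by apply: ler_pM; rewrite ?exprn_ge0//; apply: lerXn2r; rewrite ?nnegrE.
Qed.

(** The right side of the gcd relation for the model sequence n^q in place of a(n). *)
Definition floor_pow_sum (R : realType) (q n : nat) : R :=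
  \sum_(g < n) g.+1%:R * (n %/ g.+1)%:R ^+ q.

Lemma harmonic_mean_cvg (R : realType) :
  series harmonic n / n%:R @[n --> \oo] --> (0 : R).
Proof.
have /cesaro := @cvg_harmonic R; rewrite /arithmetic_mean => h.
rewrite -cvg_shiftS; apply: cvg_trans h; apply: near_eq_cvg; near=> n.
by rewrite /= mulrC.
Unshelve. all: by end_near. Qed.

(** With x = n / (g + 1), the main term is (g + 1) x^(d+1). Taking the floor costs at most (d + 1)(g
    + 1) x^d, and summing this over g gives only a harmonic sum times n^d. *)
Lemma floor_pow_term_bounds (R : realType) d n g : (2 <= d)%N ->
  (g.+1%:R ^+ d)^-1 * n%:R ^+ d.+1 - d.+1%:R * (g.+1%:R^-1 * n%:R ^+ d)
    <= g.+1%:R * (n %/ g.+1)%:R ^+ d.+1 :> R /\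
  g.+1%:R * (n %/ g.+1)%:R ^+ d.+1 <= (g.+1%:R ^+ d)^-1 * n%:R ^+ d.+1 :> R.
Proof.
move=> d2; have g0 : 0 < g.+1%:R :> R by [].
set x : R := n%:R / g.+1%:R; set y : R := (n %/ g.+1)%:R.
have yx : 0 <= y <= x.
  by rewrite ler0n /= ler_pdivlMr// -natrM ler_nat leq_trunc_div.
have xy1 : x - y <= 1.
  rewrite lerBlDl ler_pdivrMr// -[1]/(1%:R) -natrD -natrM ler_nat.
  by rewrite addn1 ltnW// ltn_ceil.
have -> : (g.+1%:R ^+ d)^-1 * n%:R ^+ d.+1 = g.+1%:R * x ^+ d.+1.
  rewrite /x exprMn exprVn (exprS g.+1%:R) invfM mulrCA mulVKf ?gt_eqF//.
  by rewrite mulrC.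
split; last first.
  rewrite ler_pM2l//; case/andP: yx => y0 yx.
  by apply: lerXn2r; rewrite ?nnegrE// (le_trans y0).
rewrite lerBlDl -lerBlDr -mulrBr.
apply: le_trans (ler_wpM2l (ltW g0) (subrXX_le d yx xy1)) _.
rewrite mulrCA ler_pM2l// /x exprMn mulrCA mulrC.
apply: ler_wpM2r; first by rewrite exprn_ge0.
(* Since d - 1 >= 1, the factor (g + 1)^-(d-1) is at most (g + 1)^-1. *)
rewrite exprVn -(prednK (ltnW d2)) exprS invfM mulVKf ?gt_eqF//.
rewrite lef_pV2 ?posrE ?exprn_gt0// ler_eXnr// ?ler1n//; lia.
Qed.

Lemma floor_pow_sum_cvg (R : realType) d : (2 <= d)%N ->
  floor_pow_sum R d.+1 n / n%:R ^+ d.+1 @[n --> \oo] --> zeta (d%:R : R).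
Proof.
move=> d2.
pose S := series (riemannR (d%:R : R)).
have cS : S n @[n --> \oo] --> zeta (d%:R : R) by exact: series_riemannR_cvg.
have cL : S n - d.+1%:R * (series harmonic n / n%:R) @[n --> \oo]
    --> zeta (d%:R : R).
  rewrite -[zeta _]subr0 -[0](mulr0 d.+1%:R).
  by apply: cvgB => //; apply: cvgM (cvg_cst _) _; exact: harmonic_mean_cvg.
apply: (squeeze_cvgr _ cL cS); near=> n.
have n0 : (0 < n)%N by near: n; exists 1%N.
have nR : 0 < n%:R :> R by rewrite ltr0n.
rewrite ler_pdivlMr ?exprn_gt0// ler_pdivrMr ?exprn_gt0//.
have -> : (S n - d.+1%:R * (series harmonic n / n%:R)) * n%:R ^+ d.+1 =
    S n * n%:R ^+ d.+1 - d.+1%:R * (series harmonic n * n%:R ^+ d).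
  by rewrite exprS; field; rewrite gt_eqF.
rewrite /S series_riemannRE /floor_pow_sum /series/= big_mkord.
rewrite !mulr_suml mulr_sumr -sumrB.
by apply/andP; split; apply: ler_sum => g _;
  case: (floor_pow_term_bounds R n g d2).
Unshelve. all: by end_near. Qed.

(** * Inversion of the gcd relation *)

(** The constant B absorbs the finitely many small n. A bound valid for every n is wanted because
    the gcd relation evaluates sequences at floor (n / g), which may be small. *)
Lemma cvg0_polyn_bound (R : realType) q (f : nat -> R) :
  f n / n%:R ^+ q @[n --> \oo] --> 0 ->
  forall e : R, 0 < e -> exists B : R, forall n, `|f n| <= e * n%:R ^+ q + B.
Proof.
move=> /cvgr0Pnorm_le f0 e e0; have [N _ fN] := f0 e e0.
exists (\sum_(k < N.+1) `|f k|) => n.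
have [nN|Nn] := ltnP n N.+1.
  rewrite (bigD1 (Ordinal nN))//= addrCA lerDl.
  by rewrite addr_ge0 ?sumr_ge0// mulr_ge0 ?exprn_ge0// ltW.
have n0 : 0 < n%:R ^+ q :> R by rewrite exprn_gt0// ltr0n; case: n Nn.
apply: ler_wpDr; first exact: sumr_ge0.
by have := fN n (ltnW Nn); rewrite /= normf_div (gtr0_norm n0) ler_pdivrMr.
Qed.

Lemma polyn_bound_cvg0 (R : realType) q (f : nat -> R) :
  (forall e : R, 0 < e -> exists B : R, forall n, `|f n| <= e * n%:R ^+ q.+1 + B) ->
  f n / n%:R ^+ q.+1 @[n --> \oo] --> 0.
Proof.
move=> fB; apply/cvgr0Pnorm_le => e e0.
have e2 : 0 < e / 2 by rewrite divr_gt0.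
have [B fBn] := fB _ e2; near=> n.
have n0 : (0 < n)%N by near: n; exists 1%N.
have nR : 1 <= n%:R :> R by rewrite ler1n.
have nq : 0 < n%:R ^+ q.+1 :> R by rewrite exprn_gt0// ltr0n.
rewrite normf_div (gtr0_norm nq) ler_pdivrMr// (le_trans (fBn n))//.
rewrite [in leRHS](splitr e) mulrDl lerD2l.
(* For such n, B <= (e / 2) n <= (e / 2) n^(q+1); the exponent has to be positive. *)
have Bn : B / (e / 2) <= n%:R by near: n; exact: nbhs_infty_ger.
rewrite mulrC -ler_pdivrMr// (le_trans Bn)//.
by apply: ler_eXnr.
Unshelve. all: by end_near. Qed.

(* Isolate the term g = 1: the terms g >= 2 contribute at most
   M n^(d+1) \sum_(g >= 2) g^-d <= 3/4 M n^(d+1), up to lower order. *)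
Lemma dirichlet_contraction (R : realType) d (D E : nat -> R) (M B : R) :
  (2 <= d)%N -> 0 < M ->
  (forall n, E n = \sum_(g < n) g.+1%:R * D (n %/ g.+1)%N) ->
  (forall e : R, 0 < e -> exists B : R, forall n, `|E n| <= e * n%:R ^+ d.+1 + B) ->
  (forall n, `|D n| <= M * n%:R ^+ d.+1 + B) ->
  exists B', forall n, `|D n| <= 7 / 8 * M * n%:R ^+ d.+1 + B'.
Proof.
move=> d2 M0 ED Eo DB.
have B0 : 0 <= B by have := DB 0%N; rewrite expr0n mulr0 add0r; exact: le_trans.
(* The budget is 7/8 = 3/4 + 1/16 + 1/16: the tail g >= 2, the error [E], and the accumulated
   constants [B]. *)
have e0 : 0 < M / 16 by rewrite divr_gt0.
have [BE EB] := Eo _ e0.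
have BE0 : 0 <= BE by have := EB 0%N; rewrite expr0n mulr0 add0r; exact: le_trans.
pose Bsq : R := B * (B / (M / 16)) ^+ 2.
have Bsq0 : 0 <= Bsq by rewrite mulr_ge0 ?sqr_ge0.
(* Beyond n = B / (M / 16), B n^2 <= (M / 16) n^3 and 3 <= d + 1; below it, [Bsq] is a bound. *)
have sqB n : B * n%:R ^+ 2 <= M / 16 * n%:R ^+ d.+1 + Bsq.
  have [nB|nB] := leP (B / (M / 16)) n%:R.
    apply: ler_wpDr => //; rewrite -[leRHS]mulrC.
    case: n nB => [|n] nB; first by rewrite !expr0n mulr0 mul0r.
    apply: le_trans (_ : n.+1%:R ^+ 3 * (M / 16) <= _); last first.
      by rewrite ler_pM2r// ler_weXn2l// ler1n.
    by rewrite [_ ^+ 3]exprSr -mulrA mulrC ler_wpM2l ?exprn_ge0// -ler_pdivrMr.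
  apply: ler_wpDl; first by rewrite mulr_ge0 ?exprn_ge0// ltW.
  rewrite ler_wpM2l// lerXn2r ?nnegrE//; last exact: ltW.
  by rewrite divr_ge0// ltW.
(* [E 0] is an empty sum and says nothing about [D 0], so n = 0 uses the hypothesis on [D]. *)
exists (BE + Bsq + B) => -[|n].
  rewrite expr0n mulr0 add0r; apply: le_trans (DB 0%N) _.
  by rewrite expr0n mulr0 add0r lerDr addr_ge0.
(* Each of the n terms carries B with a factor g + 2 <= n + 1, hence the quadratic remainder. *)
have tail : `|\sum_(g < n) g.+2%:R * D (n.+1 %/ g.+2)%N| <=
    3 / 4 * M * n.+1%:R ^+ d.+1 + B * n.+1%:R ^+ 2.
  apply: le_trans (ler_norm_sum _ _ _) _.
  apply: le_trans (_ : \sum_(g < n) ((g.+2%:R ^+ d)^-1 * (M * n.+1%:R ^+ d.+1)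
      + B * n.+1%:R) <= _).
    apply: ler_sum => g _; rewrite normrM ger0_norm//.
    apply: le_trans (ler_wpM2l _ (DB _)) _ => //; rewrite mulrDr lerD//.
      rewrite mulrCA [leRHS]mulrCA ler_pM2l//.
      by case: (floor_pow_term_bounds R n.+1 g.+1 d2).
    by rewrite mulrC ler_wpM2l// ler_nat ltnS.
  rewrite big_split/= -mulr_suml sumr_const card_ord lerD//.
    rewrite -mulrA ler_wpM2r//; last exact: sum_inv_exp_le.
    by rewrite mulr_ge0 ?exprn_ge0// ltW.
  rewrite -[leLHS]mulr_natr expr2 [leRHS]mulrA ler_wpM2l ?mulr_ge0//.
  by rewrite ler_nat.
have -> : D n.+1 = E n.+1 - \sum_(g < n) g.+2%:R * D (n.+1 %/ g.+2)%N.
  by rewrite ED big_ord_recl/= divn1 mul1r addrK.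
apply: le_trans (ler_normB _ _) _.
have := EB n.+1; have := sqB n.+1; have := tail; lra.
Qed.

Lemma dirichlet_tauberian (R : realType) d (a A : nat -> R) (alpha : R) :
  (2 <= d)%N -> (forall n, 0 <= a n) ->
  (forall n, A n = \sum_(g < n) g.+1%:R * a (n %/ g.+1)%N) ->
  A n / n%:R ^+ d.+1 @[n --> \oo] --> alpha ->
  a n / n%:R ^+ d.+1 @[n --> \oo] --> alpha / zeta (d%:R : R).
Proof.
move=> d2 a0 Aa cA.
pose K := alpha / zeta (d%:R : R).
pose D n := a n - K * n%:R ^+ d.+1.
pose E n := A n - K * floor_pow_sum R d.+1 n.
have ED n : E n = \sum_(g < n) g.+1%:R * D (n %/ g.+1)%N.
  rewrite /E Aa /floor_pow_sum mulr_sumr -sumrB; apply: eq_bigr => g _.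
  by rewrite mulrBr mulrCA.
have Eo : E n / n%:R ^+ d.+1 @[n --> \oo] --> 0.
  (* [K] is chosen so that the main terms cancel. *)
  have -> : 0 = alpha - K * zeta (d%:R : R).
    by rewrite divfK ?subrr// gt_eqF// zeta_gt0.
  under eq_fun do rewrite mulrBl -mulrA.
  by apply: cvgB => //; apply: cvgM (cvg_cst _) _; exact: floor_pow_sum_cvg.
have Ao : (A n - alpha * n%:R ^+ d.+1) / n%:R ^+ d.+1 @[n --> \oo] --> 0.
  rewrite -[0](subrr alpha); apply: cvg_trans (cvgB cA (cvg_cst alpha)).
  apply: near_eq_cvg; near=> n; rewrite mulrBl mulfK//.
  by rewrite expf_neq0// pnatr_eq0 -lt0n; near: n; exists 1%N.
have [B AB] := cvg0_polyn_bound Ao ltr01.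
(* A priori bound that starts the iteration: [a n] is the first term of a nonnegative sum, and [a 0]
   covers the empty sum at n = 0. *)
have aA n : a n <= A n + a 0%N.
  case: n => [|n]; first by rewrite Aa big_ord0 add0r.
  rewrite Aa big_ord_recl divn1 mul1r -addrA lerDl addr_ge0//.
  by apply: sumr_ge0 => g _; rewrite mulr_ge0.
pose M := `|alpha| + 1 + `|K|.
have M0 : 0 < M by rewrite /M -addrA addrCA ltr_pwDl// addr_ge0.
have DM n : `|D n| <= M * n%:R ^+ d.+1 + (B + a 0%N).
  have nq : 0 <= n%:R ^+ d.+1 :> R by rewrite exprn_ge0.
  apply: le_trans (ler_normB _ _) _.
  rewrite ger0_norm// normrM (ger0_norm nq) /M.
  have : A n <= `|alpha| * n%:R ^+ d.+1 + (1 * n%:R ^+ d.+1 + B).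
    rewrite -(subrK (alpha * n%:R ^+ d.+1) (A n)) addrC.
    by apply: lerD; [rewrite ler_wpM2r// ler_norm|exact: le_trans (ler_norm _) (AB n)].
  have := aA n; lra.
have Dk k : exists Bk, forall n, `|D n| <= (7 / 8) ^+ k * M * n%:R ^+ d.+1 + Bk.
  elim: k => [|k [Bk IH]]; first by exists (B + a 0%N); rewrite expr0 mul1r.
  rewrite exprS -!mulrA mulrA; apply: dirichlet_contraction ED _ IH => //.
    by rewrite mulr_gt0 ?exprn_gt0//; lra.
  exact: cvg0_polyn_bound.
have Do : D n / n%:R ^+ d.+1 @[n --> \oo] --> 0.
  apply: polyn_bound_cvg0 => e e0.
  have r1 : `|7 / 8 : R| < 1 by rewrite ger0_norm; lra.
  have /cvgr0Pnorm_le/(_ (e / M)) := cvg_expr r1.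
  (* Enough contractions k bring (7/8)^k M below e. *)
  rewrite divr_gt0// => /(_ isT)[k _ /(_ k (leqnn k))/= rk].
  have [Bk DBk] := Dk k; exists Bk => n.
  apply: le_trans (DBk n) _; rewrite lerD2r ler_wpM2r ?exprn_ge0//.
  by rewrite -ler_pdivlMr// (le_trans (ler_norm _)).
rewrite -/K -[K]add0r; apply: cvg_trans (cvgD Do (cvg_cst K)).
apply: near_eq_cvg; near=> n; rewrite fctE /D /= mulrBl mulfK ?subrK//.
by rewrite expf_neq0// pnatr_eq0 -lt0n; near: n; exists 1%N.
Unshelve. all: by end_near. Qed.

(** * Asymptotics *)

Lemma shifted_natr_ratio_cvg (R : realType) (c k : nat) :
  (n + c - k)%N%:R / n%:R @[n --> \oo] --> (1 : R).
Proof.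
have cV : n%:R^-1 @[n --> \oo] --> (0 : R).
  by rewrite -cvg_shiftS; exact: cvg_harmonic.
have : 1 + (c%:R - k%:R) * n%:R^-1 @[n --> \oo] --> (1 + (c%:R - k%:R) * 0 : R).
  by apply: cvgD; [exact: cvg_cst|exact: cvgM (cvg_cst _) cV].
rewrite mulr0 addr0; apply: cvg_trans; apply: near_eq_cvg; near=> n.
have n0 : (0 < n)%N by near: n; exists 1%N.
(* From here on the truncated subtraction is the true one. *)
have kn : (k <= n)%N by near: n; exists k.
rewrite natrB ?natrD; last by rewrite (leq_trans kn) ?leq_addr.
by field; rewrite pnatr_eq0 -lt0n.
Unshelve. all: by end_near. Qed.

(** The falling factorial has q factors, each asymptotic to n. The limit does not depend on the
    shift c, so both bounds on A(n) share it. *)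
Lemma bin_cvg (R : realType) (c q : nat) :
  'C(n + c, q)%:R / n%:R ^+ q @[n --> \oo] --> (q`!%:R^-1 : R).
Proof.
have ff : ((n + c) ^_ q)%:R / n%:R ^+ q @[n --> \oo] --> (1 : R).
  elim: q => [|q IH].
    by under eq_fun do rewrite ffactn0 expr0 divr1; exact: cvg_cst.
  under eq_fun do rewrite ffactnSr natrM exprSr invfM mulrACA.
  have := cvgM IH (@shifted_natr_ratio_cvg R c q); rewrite mulr1; exact.
have q0 : q`!%:R != 0 :> R by rewrite pnatr_eq0 -lt0n fact_gt0.
under eq_fun => n do
  rewrite -[_%:R](mulfK q0) -natrM bin_ffact mulrAC.
by have := cvgM ff (cvg_cst (q`!%:R^-1 : R)); rewrite mul1r; exact.
Qed.

Lemma coord_mass_ball1_cvg (R : realType) d :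
  (coord_mass (ball1 d.+1 n) ord0)%:~R / n%:R ^+ d.+2 @[n --> \oo]
    --> (2 ^+ d.+1 / (d.+2)`!%:R : R).
Proof.
have bc c : 2 ^+ d.+1 * ('C(n + c, d.+2)%:R / n%:R ^+ d.+2) @[n --> \oo]
    --> (2 ^+ d.+1 / (d.+2)`!%:R : R).
  by apply: cvgM (cvg_cst _) _; exact: bin_cvg.
apply: (squeeze_cvgr _ (bc 1%N) (bc d.+1)); near=> n.
have n0 : (0 < n)%N by near: n; exists 1%N.
rewrite !mulrA ler_pM2r ?invr_gt0 ?exprn_gt0 ?ltr0n//.
rewrite ler_pM2r ?invr_gt0 ?exprn_gt0 ?ltr0n//.
have := coord_mass_ball1_bounds d n.
by rewrite -!(ler_int R) -!pmulrn !natrM !natrX addn1.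
Unshelve. all: by end_near. Qed.

Theorem theorem4p2 (R : realType) (d : nat) (hd : (2 <= d)%N) :
  (fun p : nat => (cube_size (H1 R d p))%:~R / p%:R ^+ d.+1 : R) @ \oo -->
  (2 ^+ d.-1 / ((d.+1)`!%:R * zeta (d%:R : R)) : R).
Proof.
case: d hd => // d hd.
pose a n : R := (coord_mass (prim_ball d.+1 n) ord0)%:~R.
pose A n : R := (coord_mass (ball1 d.+1 n) ord0)%:~R.
have a0 n : 0 <= a n by rewrite ler0z fsumr_ge0.
have Aa n : A n = \sum_(g < n) g.+1%:R * a (n %/ g.+1)%N.
  (* The term g = 0 has weight 0; removing it shifts the index to [g.+1]. *)
  rewrite /A coord_mass_gcd big_ord_recl mul0r add0r rmorph_sum/=.
  by apply: eq_bigr => g _; rewrite intrM.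
(* The factor 1/2 passes from all primitive points to the generators. *)
have := cvgM (cvg_cst (2^-1 : R))
  (dirichlet_tauberian hd a0 Aa (@coord_mass_ball1_cvg R d)).
have -> : 2^-1 * (2 ^+ d.+1 / (d.+2)`!%:R / zeta (d.+1%:R : R)) =
    2 ^+ d.+1.-1 / ((d.+2)`!%:R * zeta (d.+1%:R : R)).
  by rewrite /= exprS -!mulrA mulKf// invfM.
move=> h; rewrite (_ : (fun p : nat => _) =
  (fun n => 2^-1 * (a n / n%:R ^+ d.+2))); first exact: h.
apply/funext => n.
by rewrite cube_size_H1 /a coord_mass_prim_ballE intrM -!mulrA mulKf.
Qed.
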